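(* Let $n\ge1$ be an integer and let $\{u_i\}_{i=0}^{n}$ and $\{v_i\}_{i=0}^{n}$ be two sequences of (compact, nonempty) real intervals with $u_0=v_0=[0,0]$. If $(u_i)$ and $(v_i)$ are synchronous monotone and both are $\mu$-increasing, then $$\sum_{i=1}^{n}\big\|u_{i-1}\cdot\nabla v_i+v_i\cdot\nabla u_i\big\|\le\frac n2\sum_{i=1}^{n}\big\|(\nabla u_i)^2+(\nabla v_i)^2\big\|.$$
   Context: An interval is $u=[\underline{u},\overline{u}]=\{t\in\mathbb{R}:\underline{u}\le t\le\overline{u}\}$ with $\underline u\le\overline u$ real; $len(u)=\overline u-\underline u$. Sum: $u+v=[\underline u+\underline v,\overline u+\overline v]$. Product: $u\cdot v=[\min S,\max S]$ with $S=\{\underline u\,\underline v,\ \underline u\,\overline v,\ \overline u\,\underline v,\ \overline u\,\overline v\}$. Power: $u^{2}=\{t^{2}:t\in u\}$. gH-difference: $u\ominus_g v=[\min\{\underline u-\underline v,\overline u-\overline v\},\max\{\underline u-\underline v,\overline u-\overline v\}]$. Backward gH-difference operator: $\nabla u_i=u_i\ominus_g u_{i-1}$. Quasi-norm: $\|u\|=\max\{|\underline u|,|\overline u|\}$. A sequence $(u_i)$ of intervals is increasing (decreasing) if both real sequences $(\underline{u_i})$ and $(\overline{u_i})$ are increasing (decreasing), in the weak sense. Two sequences are synchronous monotone if they have the same monotonicity, i.e. both are increasing or both are decreasing. A sequence is $\mu$-increasing if the real sequence $(len(u_i))$ is increasing (weakly). *)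

(* Defs.v *)
From mathcomp Require Import all_boot all_order all_algebra.
From mathcomp Require Import classical_sets reals.

Set Implicit Arguments.
Unset Strict Implicit.
Unset Printing Implicit Defensive.

Import Order.TTheory GRing.Theory Num.Theory.

Local Open Scope ring_scope.
Local Open Scope classical_set_scope.

Record cinterval (R : realType) := CInterval {
  lo : R;
  hi : R;
  lo_le_hi : lo <= hi }.

Definition cset (R : realType) (u : cinterval R) : set R :=
  [set x | lo u <= x <= hi u].

Definition cpoint (R : realType) (a : R) : cinterval R :=
  CInterval (lexx a).

Definition len (R : realType) (u : cinterval R) : R := hi u - lo u.

Definition iadd (R : realType) (u v : cinterval R) : cinterval R :=
  CInterval (lerD (lo_le_hi u) (lo_le_hi v)).

Definition min4 (R : realType) (a b c d : R) : R :=
  Num.min (Num.min a b) (Num.min c d).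
Definition max4 (R : realType) (a b c d : R) : R :=
  Num.max (Num.max a b) (Num.max c d).

Fact min4_le_max4 (R : realType) (a b c d : R) : min4 a b c d <= max4 a b c d.
Proof. by rewrite /min4 /max4 !ge_min !le_max lexx. Qed.

Definition imul (R : realType) (u v : cinterval R) : cinterval R :=
  CInterval (min4_le_max4 (lo u * lo v) (lo u * hi v) (hi u * lo v)
                          (hi u * hi v)).

Fact isqr_subproof (R : realType) (u : cinterval R) :
  (if (lo u <= 0) && (0 <= hi u) then 0
   else Num.min (lo u ^+ 2) (hi u ^+ 2)) <= Num.max (lo u ^+ 2) (hi u ^+ 2).
Proof.
by case: ifP => _; rewrite ?ge_min !le_max ?sqr_ge0 ?lexx.
Qed.

(* Endpoints of {t ^+ 2 : t in u}; this is not imul u u when u straddles 0.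
   The set-theoretic description is cset_isqr below. *)
Definition isqr (R : realType) (u : cinterval R) : cinterval R :=
  CInterval (isqr_subproof u).

Lemma cset_isqr (R : realType) (u : cinterval R) :
  cset (isqr u) = [set t ^+ 2 | t in cset u].
Proof.
case: u => a b ab; rewrite /cset /isqr /=; apply/seteqP; split => x /=.
- rewrite le_max => /andP[lx ux].
  have x0 : 0 <= x.
    by apply: le_trans lx; case: ifP => _; rewrite ?le_min ?sqr_ge0.
  set s := Num.sqrt x.
  have sx : s ^+ 2 = x by rewrite sqr_sqrtr.
  have s0 : 0 <= s by apply: sqrtr_ge0.
  case: (leP 0 a) => [a0|a0].
    have b0 := le_trans a0 ab.
    have ax : a ^+ 2 <= s ^+ 2.
      move: lx; rewrite sx b0 andbT; case: ifP => [a0' _|_].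
        by rewrite (@le_anti _ _ a 0) ?a0' // expr0n.
      by rewrite (min_idPl _) // ler_sqr.
    have xb : s ^+ 2 <= b ^+ 2.
      rewrite sx; case/orP: ux => // /le_trans; apply; by rewrite ler_sqr.
    rewrite !ler_sqr // in ax xb.
    by exists s => //=; rewrite ax xb.
  case: (leP b 0) => [b0|b0].
    have a0' := ltW a0.
    have ba : b ^+ 2 <= a ^+ 2.
      by rewrite -(sqrrN a) -(sqrrN b) ler_sqr ?nnegrE ?oppr_ge0 // lerN2.
    have bx : b ^+ 2 <= s ^+ 2.
      move: lx; rewrite sx a0' /=; case: ifP => [b0' _|_].
        by rewrite (@le_anti _ _ b 0) ?b0 ?b0' // expr0n.
      by rewrite (min_idPr _).
    have xa : s ^+ 2 <= a ^+ 2.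
      rewrite sx; case/orP: ux => // /le_trans; exact.
    exists (- s); last by rewrite sqrrN.
    rewrite -(sqrrN a) -(sqrrN b) !ler_sqr ?nnegrE ?oppr_ge0 // in xa bx.
    by rewrite /= lerNr lerNl xa bx.
  case/orP: ux => [xa|xb].
    exists (- s); last by rewrite sqrrN.
    rewrite /= lerNr (@le_trans _ _ 0 (- s)) ?oppr_le0 ?(ltW b0) //.
    by rewrite andbT -ler_sqr ?nnegrE ?oppr_ge0 ?(ltW a0) // sqrrN sx.
  exists s => //=; rewrite (le_trans (ltW a0)) //=.
  by rewrite -ler_sqr ?nnegrE ?(ltW b0) // sx.
- case=> t; rewrite /= => /andP[at_ tb] <-.
  case: (leP 0 t) => [t0|t0].
    have b0 := le_trans t0 tb.
    rewrite b0 andbT le_max [t ^+ 2 <= b ^+ 2]ler_sqr // tb orbT andbT.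
    case: ifP => [_|/negbT]; first exact: sqr_ge0.
    by rewrite -ltNge => a0; rewrite ge_min ler_sqr ?nnegrE ?(ltW a0) // at_.
  have a0 := le_trans at_ (ltW t0).
  have ta : t ^+ 2 <= a ^+ 2.
    rewrite -(sqrrN t) -(sqrrN a).
    by rewrite ler_sqr ?nnegrE ?oppr_ge0 ?(ltW t0) // lerN2.
  rewrite a0 le_max ta andbT /=.
  case: ifP => [_|/negbT]; first exact: sqr_ge0.
  rewrite -ltNge => b0; rewrite ge_min; apply/orP; right.
  rewrite -(sqrrN b) -(sqrrN t).
  by rewrite ler_sqr ?nnegrE ?oppr_ge0 ?(ltW b0) ?(ltW t0) // lerN2.
Qed.

Fact min_le_max (R : realType) (a b : R) : Num.min a b <= Num.max a b.
Proof. by rewrite ge_min !le_max lexx. Qed.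

Definition gHdiff (R : realType) (u v : cinterval R) : cinterval R :=
  CInterval (min_le_max (lo u - lo v) (hi u - hi v)).

(* Only meaningful for 1 <= i, as i.-1 is truncated. *)
Definition nabla (R : realType) (u : nat -> cinterval R) (i : nat) :
    cinterval R :=
  gHdiff (u i) (u i.-1).

Definition qnorm (R : realType) (u : cinterval R) : R :=
  Num.max `|lo u| `|hi u|.

(* A finite sequence indexed by {0, ..., n} is a function on nat of which only
   the values at indices <= n are constrained. *)
Definition rincreasing (R : realType) (n : nat) (x : nat -> R) : Prop :=
  forall i j : nat, (i <= j)%N -> (j <= n)%N -> x i <= x j.

Definition rdecreasing (R : realType) (n : nat) (x : nat -> R) : Prop :=
  forall i j : nat, (i <= j)%N -> (j <= n)%N -> x j <= x i.

Definition increasing (R : realType) (n : nat) (u : nat -> cinterval R) : Prop :=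
  rincreasing n (fun i => lo (u i)) /\ rincreasing n (fun i => hi (u i)).

Definition decreasing (R : realType) (n : nat) (u : nat -> cinterval R) : Prop :=
  rdecreasing n (fun i => lo (u i)) /\ rdecreasing n (fun i => hi (u i)).

Definition synchronous_monotone (R : realType) (n : nat)
    (u v : nat -> cinterval R) : Prop :=
  (increasing n u /\ increasing n v) \/ (decreasing n u /\ decreasing n v).

Definition mu_increasing (R : realType) (n : nat) (u : nat -> cinterval R) :
    Prop :=
  rincreasing n (fun i => len (u i)).

(* Main.v *)
Require Import Defs.
From mathcomp Require Import all_boot all_order all_algebra.
From mathcomp Require Import reals.
From mathcomp Require Import ring lra.

Import Order.TTheory GRing.Theory Num.Theory.
Local Open Scope ring_scope.

(** Write [a i] and [b i] for the quasi-norms of [u i] and [v i].  Since both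
    sequences start at [0, 0], monotonicity keeps every interval on one side of
    the origin, so the quasi-norm is the modulus of the outer endpoint; growing
    lengths make the outer endpoint move the faster of the two.  Hence the
    quasi-norm of [nabla u i] is exactly the increment [a i - a i.-1]
    ([qnorm_nabla]), whether the sequences increase or decrease.

    By subadditivity and submultiplicativity of the quasi-norm, the left-hand
    summands are at most [a i.-1 * (b i - b i.-1) + b i * (a i - a i.-1)],
    which is [a i * b i - a i.-1 * b i.-1]; the left-hand side is thus at most
    [a n * b n].  On the right the summands are exactly
    [(a i - a i.-1) ^+ 2 + (b i - b i.-1) ^+ 2], because squares of intervals
    lie in the nonnegative half-line, where the quasi-norm is additive.  What
    remains is [a n * b n <= (a n ^+ 2 + b n ^+ 2) / 2] together with the
    Cauchy-Schwarz inequality for the [n] increments that add up to [a n], and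
    for those that add up to [b n].  This is a discrete form of the classical
    proof of Opial's inequality. *)

(** * The quasi-norm and interval arithmetic *)

Section QuasiNorm.
Variable R : realType.
Implicit Types u v : cinterval R.

Lemma qnorm_le u (c : R) : (qnorm u <= c) = (- c <= lo u) && (hi u <= c).
Proof.
rewrite /qnorm ge_max !ler_norml.
have := lo_le_hi u; set a := lo u; set b := hi u => ab.
apply/idP/idP => [/andP[/andP[-> _] /andP[_ ->]] //|/andP[ca bc]].
by rewrite ca bc (le_trans ab bc) (le_trans ca ab).
Qed.

Lemma qnorm_ge0_endpoint {u} : 0 <= lo u -> qnorm u = hi u.
Proof.
move=> u0; have u1 := le_trans u0 (lo_le_hi u).
by rewrite /qnorm !ger0_norm // max_r // lo_le_hi.
Qed.

Lemma qnorm_le0_endpoint {u} : hi u <= 0 -> qnorm u = - lo u.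
Proof.
move=> u1; have u0 := le_trans (lo_le_hi u) u1.
by rewrite /qnorm !ler0_norm // max_l // lerN2 lo_le_hi.
Qed.

Lemma qnorm_iadd_le u v : qnorm (iadd u v) <= qnorm u + qnorm v.
Proof.
have := lexx (qnorm u); have := lexx (qnorm v).
rewrite !qnorm_le /= => /andP[v1 v2] /andP[u1 u2].
by rewrite opprD !lerD.
Qed.

Lemma qnorm_imul_le u v : qnorm (imul u v) <= qnorm u * qnorm v.
Proof.
have bnd x y : `|x| <= qnorm u -> `|y| <= qnorm v ->
    (- (qnorm u * qnorm v) <= x * y) && (x * y <= qnorm u * qnorm v).
  by move=> xu yv; rewrite -ler_norml normrM ler_pM.
have lu : `|lo u| <= qnorm u by rewrite le_max lexx.
have hu : `|hi u| <= qnorm u by rewrite le_max lexx orbT.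
have lv : `|lo v| <= qnorm v by rewrite le_max lexx.
have hv : `|hi v| <= qnorm v by rewrite le_max lexx orbT.
have /andP[a1 a2] := bnd _ _ lu lv; have /andP[b1 b2] := bnd _ _ lu hv.
have /andP[c1 c2] := bnd _ _ hu lv; have /andP[d1 d2] := bnd _ _ hu hv.
rewrite qnorm_le /= /min4 /max4 !le_min !ge_max.
by rewrite a1 a2 b1 b2 c1 c2 d1 d2.
Qed.

Lemma lo_isqr_ge0 u : 0 <= lo (isqr u).
Proof. by rewrite /=; case: ifP => // _; rewrite le_min !sqr_ge0. Qed.

Lemma hi_isqr u : hi (isqr u) = qnorm u ^+ 2.
Proof.
rewrite /= /qnorm -[lo u ^+ 2]real_normK ?num_real //.
rewrite -[hi u ^+ 2]real_normK ?num_real //.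
case: (leP `|lo u| `|hi u|) => h; first by rewrite max_r // ler_sqr ?nnegrE.
by rewrite max_l // ler_sqr ?nnegrE // ltW.
Qed.

Lemma qnorm_iadd_isqr u v :
  qnorm (iadd (isqr u) (isqr v)) = qnorm u ^+ 2 + qnorm v ^+ 2.
Proof.
rewrite qnorm_ge0_endpoint; first by rewrite -!hi_isqr.
by apply: addr_ge0; apply: lo_isqr_ge0.
Qed.

(** When the length does not shrink, the difference of the lower endpoints is
    the smaller one, and the gH-difference is computed endpoint by endpoint. *)
Lemma lo_gHdiff u v : len v <= len u -> lo (gHdiff u v) = lo u - lo v.
Proof. by rewrite /len => uv; rewrite /= min_l //; lra. Qed.

Lemma hi_gHdiff u v : len v <= len u -> hi (gHdiff u v) = hi u - hi v.
Proof. by rewrite /len => uv; rewrite /= max_r //; lra. Qed.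

(** Both [v] and the gH-difference lie on the nonnegative side, so only upper
    endpoints contribute to the quasi-norms. *)
Lemma qnorm_gHdiff_ge0 u v :
  0 <= lo v -> lo v <= lo u -> len v <= len u ->
  qnorm (gHdiff u v) = qnorm u - qnorm v.
Proof.
move=> v0 vu l; rewrite (qnorm_ge0_endpoint v0).
rewrite (qnorm_ge0_endpoint (le_trans v0 vu)) -hi_gHdiff //.
by rewrite qnorm_ge0_endpoint // lo_gHdiff // subr_ge0.
Qed.

Lemma qnorm_gHdiff_le0 u v :
  hi v <= 0 -> hi u <= hi v -> len v <= len u ->
  qnorm (gHdiff u v) = qnorm u - qnorm v.
Proof.
move=> v0 uv l; rewrite (qnorm_le0_endpoint v0).
rewrite (qnorm_le0_endpoint (le_trans uv v0)) -opprD -lo_gHdiff //.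
by rewrite qnorm_le0_endpoint // hi_gHdiff // subr_le0.
Qed.

(** Monotonicity from [0, 0] keeps all the intervals on one side of the
    origin; this makes the quasi-norm turn gH-differences into differences. *)
Lemma qnorm_nabla (n : nat) (w : nat -> cinterval R) (i : nat) :
  w 0%N = cpoint 0 -> increasing n w \/ decreasing n w -> mu_increasing n w ->
  (i <= n)%N -> qnorm (nabla w i) = qnorm (w i) - qnorm (w i.-1).
Proof.
move=> w0 mono mu in_; have pn := leq_trans (leq_pred i) in_.
have l := mu _ _ (leq_pred i) in_.
case: mono => -[wlo whi].
  apply: qnorm_gHdiff_ge0 => //; last exact: wlo (leq_pred i) in_.
  by have := wlo _ _ (leq0n _) pn; rewrite w0.
apply: qnorm_gHdiff_le0 => //; last exact: whi (leq_pred i) in_.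
by have := whi _ _ (leq0n _) pn; rewrite w0.
Qed.

End QuasiNorm.

(** * Real sequences *)

(** Cauchy-Schwarz against the constant sequence: expand the nonnegative sum
    of the squares [(x i - y) ^+ 2], with [y] the new term, at each step. *)
Lemma sqr_sum_le (R : realFieldType) (x : nat -> R) (n : nat) :
  (\sum_(1 <= i < n.+1) x i) ^+ 2 <= n%:R * \sum_(1 <= i < n.+1) x i ^+ 2.
Proof.
elim: n => [|n IHn]; first by rewrite !big_geq // expr0n mul0r.
have var y : 0 <= \sum_(1 <= i < n.+1) x i ^+ 2
    - 2 * y * (\sum_(1 <= i < n.+1) x i) + n%:R * y ^+ 2.
  have -> : n%:R * y ^+ 2 = \sum_(1 <= i < n.+1) y ^+ 2.
    by rewrite sumr_const_nat subn1 mulr_natl.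
  rewrite mulr_sumr -sumrB -big_split /=.
  apply: sumr_ge0 => i _.
  have -> : x i ^+ 2 - 2 * y * x i + y ^+ 2 = (x i - y) ^+ 2 by ring.
  exact: sqr_ge0.
rewrite ![\sum_(1 <= i < n.+2) _]big_nat_recr //= -natr1.
have := var (x n.+1); move: IHn.
set S := \sum_(1 <= i < n.+1) x i; set Q := \sum_(1 <= i < n.+1) x i ^+ 2.
set y := x n.+1 => IHn h.
rewrite -subr_ge0; rewrite -subr_ge0 in IHn.
by apply: le_trans (addr_ge0 IHn h) _; rewrite le_eqVlt; apply/orP; left;
  apply/eqP; ring.
Qed.

Lemma telescope_from1 (R : zmodType) (f : nat -> R) (n : nat) :
  \sum_(1 <= i < n.+1) (f i - f i.-1) = f n - f 0%N.
Proof. by rewrite big_add1 /= telescope_sumr. Qed.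

(** The discrete product rule makes the left-hand side telescope to
    [a n * b n], which AM-GM and Cauchy-Schwarz bound. *)
Lemma discrete_opial (R : realFieldType) (a b : nat -> R) (n : nat) :
  a 0%N = 0 -> b 0%N = 0 ->
  \sum_(1 <= i < n.+1) (a i.-1 * (b i - b i.-1) + b i * (a i - a i.-1))
  <= n%:R / 2%:R *
     \sum_(1 <= i < n.+1) ((a i - a i.-1) ^+ 2 + (b i - b i.-1) ^+ 2).
Proof.
move=> a0 b0.
under eq_bigr => i _.
  have -> : a i.-1 * (b i - b i.-1) + b i * (a i - a i.-1)
      = a i * b i - a i.-1 * b i.-1 by ring.
  over.
rewrite (telescope_from1 _ (fun i => a i * b i)) a0 mul0r subr0 big_split /=.
have := sqr_sum_le _ (fun i => a i - a i.-1) n.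
have := sqr_sum_le _ (fun i => b i - b i.-1) n.
rewrite !telescope_from1 a0 b0 !subr0.
have := sqr_ge0 (a n - b n).
set B := \sum_(_ <= _ < _) _; set A := \sum_(_ <= _ < _) _ => ab hb ha.
have -> : n%:R / 2%:R * (A + B) = (n%:R * A + n%:R * B) / 2%:R :> R by field.
rewrite ler_pdivlMr ?ltr0n //; nra.
Qed.

(** * The inequality for interval sequences *)

Theorem theorem3p14 (R : realType) (n : nat) (u v : nat -> cinterval R)
  (n_ge1 : (1 <= n)%N)
  (u0 : u 0%N = cpoint (0 : R)) (v0 : v 0%N = cpoint (0 : R))
  (uv_sync : synchronous_monotone n u v)
  (u_mu : mu_increasing n u) (v_mu : mu_increasing n v) :
  \sum_(1 <= i < n.+1)
      qnorm (iadd (imul (u i.-1) (nabla v i)) (imul (v i) (nabla u i)))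
  <= n%:R / 2%:R *
     \sum_(1 <= i < n.+1) qnorm (iadd (isqr (nabla u i)) (isqr (nabla v i))).
Proof.
have u_mono : increasing n u \/ decreasing n u.
  by case: uv_sync => -[? _]; [left|right].
have v_mono : increasing n v \/ decreasing n v.
  by case: uv_sync => -[_ ?]; [left|right].
have norm0 : qnorm (cpoint (0 : R)) = 0 by rewrite qnorm_ge0_endpoint.
have := @discrete_opial R (fun i => qnorm (u i)) (fun i => qnorm (v i)) n.
rewrite u0 v0 norm0 => /(_ erefl erefl) opial.
rewrite [X in _ <= _ * X](eq_big_nat _ _ (F2 := fun i =>
  (qnorm (u i) - qnorm (u i.-1)) ^+ 2 + (qnorm (v i) - qnorm (v i.-1)) ^+ 2));
  last first.
  by move=> i /andP[_ in_]; rewrite qnorm_iadd_isqr !(@qnorm_nabla _ n).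
apply: le_trans opial; apply: ler_sum_nat => i /andP[_ in_].
rewrite -(@qnorm_nabla _ n u i) // -(@qnorm_nabla _ n v i) //.
by apply: le_trans (qnorm_iadd_le _ _ _) _; apply: lerD; apply: qnorm_imul_le.
Qed.
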